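(* Let $f:(0,1)\to(0,1)$. If there is a pushdown automaton that simulates $f$ (for all $p\in(0,1)$), then $f$ is algebraic over $\mathbb Q$: there exists a nonzero polynomial $P\in\mathbb Q[X,Y]$ such that $P(f(p),p)=0$ for all $p\in(0,1)$.
   Context: For $w\in\{0,1\}^*$ let $n_i(w)$ be the number of occurrences of $i$ in $w$; for $p\in(0,1)$ put $\mathbf P_p[w]=p^{n_1(w)}(1-p)^{n_0(w)}$ and $\mathbf P_p[L]=\sum_{w\in L}\mathbf P_p[w]$. A simulation of $f:\mathcal D\to[0,1]$ ($\mathcal D\subseteq(0,1)$) is a pair of disjoint languages $L_0,L_1\subseteq\{0,1\}^*$ with $L_0\cup L_1$ prefix-free (no string is a proper prefix of another) such that $\mathbf P_p[L_0\cup L_1]=1$ and $\mathbf P_p[L_1]=f(p)$ for all $p\in\mathcal D$. A (deterministic) pushdown automaton over input alphabet $\{0,1\}$ consists of a finite state set $S$ with start state $s_0$, a finite stack alphabet $\Lambda$, an initial nonempty stack word $\tau\in\Lambda^*$ (leftmost symbol is the top), a transition map assigning to each $(s,x,b)\in S\times\{0,1\}\times\Lambda$ a new state $\sigma(s,x,b)\in S$ and a word $\rho(s,x,b)\in\Lambda^*$, and two disjoint sets $S_0,S_1\subseteq S$. At each step the automaton reads one input bit $x$; if it is in state $s$ with stack $bu$ ($b$ on top), it moves to state $\sigma(s,x,b)$ with stack $\rho(s,x,b)u$. It stops as soon as the stack is empty, and outputs $i$ if it then is in a state of $S_i$. Let $L_i$ be the set of input strings $w$ such that the stack becomes empty for the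 first time exactly after reading the last symbol of $w$ and the state at that moment lies in $S_i$. The pushdown automaton simulates $f$ if $(L_0,L_1)$ is a simulation of $f$. *)

(* Defs.v *)
From HB Require Import structures.
From mathcomp Require Import all_boot all_order all_algebra.
From mathcomp Require Import all_classical all_reals all_analysis.
Set Implicit Arguments. Unset Strict Implicit. Unset Printing Implicit Defensive.
Import Order.TTheory GRing.Theory Num.Theory.
Local Open Scope ring_scope.

Record pda (S Lam : finType) := Pda {
  pda_s0 : S;
  pda_tau : seq Lam;                      (* initial stack, head = top *)
  pda_sigma : S -> bool -> Lam -> S;
  pda_rho : S -> bool -> Lam -> seq Lam;
  pda_S0 : {set S};
  pda_S1 : {set S};
  pda_tau_nonempty : pda_tau != [::];
  pda_S01_disjoint : [disjoint pda_S0 & pda_S1]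
}.

Local Open Scope classical_set_scope.

(* Words over {0,1} are [seq bool]; the bit 1 is [true], the bit 0 is [false]. *)

Definition n1 (w : seq bool) : nat := count id w.
Definition n0 (w : seq bool) : nat := count negb w.

Definition Pword (R : realType) (p : R) (w : seq bool) : R :=
  p ^+ n1 w * (1 - p) ^+ n0 w.

Definition Plang (R : realType) (p : R) (L : set (seq bool)) : \bar R :=
  (\esum_(w in L) (Pword p w)%:E)%E.

Definition prefix_free (L : set (seq bool)) : Prop :=
  forall u v, L u -> L v -> prefix u v -> u = v.

Definition simulation (R : realType) (D : set R) (f : R -> R)
    (L0 L1 : set (seq bool)) : Prop :=
  [/\ L0 `&` L1 = set0,
      prefix_free (L0 `|` L1),
      forall p, D p -> Plang p (L0 `|` L1) = 1%E &
      forall p, D p -> Plang p L1 = (f p)%:E].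

Section PDARun.
Variables (S Lam : finType) (A : pda S Lam).

Definition pda_step (c : S * seq Lam) (x : bool) : S * seq Lam :=
  match c.2 with
  | [::] => c
  | b :: u => (pda_sigma A c.1 x b, pda_rho A c.1 x b ++ u)
  end.

Definition pda_run (w : seq bool) : S * seq Lam :=
  foldl pda_step (pda_s0 A, pda_tau A) w.

Definition pda_lang (i : bool) : set (seq bool) :=
  [set w | (forall k, (k < size w)%N -> (pda_run (take k w)).2 != [::]) /\
           (pda_run w).2 = [::] /\
           (pda_run w).1 \in (if i then pda_S1 A else pda_S0 A)].

Definition pda_simulates (R : realType) (D : set R) (f : R -> R) : Prop :=
  simulation D f (pda_lang false) (pda_lang true).
End PDARun.

(* Evaluation of P in Q[X,Y], represented as a polynomial in X whose
   coefficients are polynomials in Y: P(x,y). *)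
Definition peval2 (R : realType) (P : {poly {poly rat}}) (x y : R) : R :=
  (map_poly (fun q : {poly rat} => (map_poly (ratr : rat -> R) q).[y]) P).[x].

(* Main.v *)
(* Let z(s,b,r) be the probability that, started in state s with stack b, the
   automaton first empties its stack in state r.  The vector z is the least
   nonnegative solution of a polynomial system z = G(p,z), and f(p) is a
   polynomial F in z.  The system may be degenerate, so it is perturbed to
   e z_i^D + z_i = G_i(p,z) with D larger than all the degrees in G.
   - For e > 0 every monomial in z reduces, up to a power of e, to monomials with
     exponents below D, so that multiplication by F becomes a matrix over Q[e,p],
     whose characteristic polynomial yields Q(X,e,p) <> 0 vanishing at F(z) for
     every solution (p,e,z).
   - The perturbed system has a solution z_e between 0 and z (Knaster-Tarski), and
     the probability of acceptance within k steps is at most (1+e)^k F(z_e);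
     hence F(z_e) tends to f(p) as e -> 0.
   Dividing Q by the largest possible power of e and letting e -> 0 gives P. *)
Require Import Defs.
From HB Require Import structures.
From mathcomp Require Import all_boot all_order all_algebra.
From mathcomp Require Import all_classical all_reals all_analysis.
From mathcomp Require Import polyXY ring lra.
Import Order.TTheory GRing.Theory Num.Theory.
Import numFieldNormedType.Exports.
Local Open Scope classical_set_scope.
Local Open Scope ring_scope.
Set Implicit Arguments. Unset Strict Implicit.

(** * Elimination in the perturbed system *)

Section Evaluation.
Variable R : realType.

Definition evp (p : R) : {poly rat} -> R := horner_eval p \o map_poly ratr.
HB.instance Definition _ p :=
  GRing.RMorphism.copy (evp p) (horner_eval p \o map_poly ratr).

(** The value of [peval2] as a composite of ring morphisms, so that it can be pushed through sums,
    products and characteristic polynomials. *)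
Definition ev2 (x y : R) : {poly {poly rat}} -> R :=
  horner_eval x \o map_poly (evp y).
HB.instance Definition _ x y :=
  GRing.RMorphism.copy (ev2 x y) (horner_eval x \o map_poly (evp y)).

Lemma peval2E (P : {poly {poly rat}}) (x y : R) : peval2 P x y = ev2 x y P.
Proof. by []. Qed.

Lemma evpX p : evp p 'X = p.
Proof. by rewrite /evp /= map_polyX /horner_eval hornerX. Qed.

Lemma ev2X x y : ev2 x y 'X = x.
Proof. by rewrite /ev2 /= map_polyX /horner_eval hornerX. Qed.

Lemma ev2C x y q : ev2 x y q%:P = evp y q.
Proof. by rewrite /ev2 /= map_polyC /horner_eval hornerC. Qed.

(** The variables of [Q] are, from the outside in, X, e and p. The swap makes e outermost, where its
    multiplicity as a factor can be read off. *)
Lemma horner_ev2_swapXY (Q : {poly {poly {poly rat}}}) (x e p : R) :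
  (map_poly (ev2 x p) (swapXY Q)).[e] = (map_poly (ev2 e p) Q).[x].
Proof.
elim/poly_ind: Q => [|Q q IH]; first by rewrite !raddf0 !horner0.
rewrite !raddfD /= !hornerD !rmorphM /= swapXY_X !hornerM IH.
rewrite swapXY_polyC !map_polyC !map_polyX !hornerC !hornerX /=.
congr (_ + _); first by rewrite ev2X.
by rewrite -map_poly_comp; congr (_.[_]); apply: eq_map_poly => c /=; rewrite ev2C.
Qed.

End Evaluation.

(** * Polynomial functions of the unknowns z with coefficients in Q[p] *)

Section Monomials.
Variables (R : realType) (I : finType).
Implicit Types (a b : I -> nat) (z : I -> R).

Definition mon a z : R := \prod_i z i ^+ a i.

Lemma monD a b z : mon (fun i => a i + b i)%N z = mon a z * mon b z.
Proof. by rewrite /mon -big_split; apply: eq_bigr => i _; rewrite exprD. Qed.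

Lemma mon0 z : mon (fun=> 0%N) z = 1.
Proof. by rewrite /mon big1. Qed.

Lemma monU i z n : mon (fun j => if j == i then n else 0%N) z = z i ^+ n.
Proof.
rewrite /mon (bigD1 i) //= eqxx big1 ?mulr1 // => j /negPf ->.
by rewrite expr0.
Qed.

Definition evterms (T : seq ({poly rat} * (I -> nat))) (p : R) z : R :=
  \sum_(t <- T) evp p t.1 * mon t.2 z.

(** Only values count: exponents may repeat in [T], so sums are concatenations and products are
    lists of pairs. *)
Definition polynomial (g : R -> (I -> R) -> R) : Prop :=
  exists T, forall p z, g p z = evterms T p z.

Lemma polynomial_coef (q : {poly rat}) : polynomial (fun p _ => evp p q).
Proof.
exists [:: (q, fun=> 0%N)] => p z.
by rewrite /evterms big_seq1 mon0 mulr1.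
Qed.

Lemma polynomial_var i : polynomial (fun _ z => z i).
Proof.
exists [:: (1, fun j => if j == i then 1%N else 0%N)] => p z.
by rewrite /evterms big_seq1 /= monU rmorph1 mul1r.
Qed.

Lemma polynomialD g h :
  polynomial g -> polynomial h -> polynomial (fun p z => g p z + h p z).
Proof.
move=> [T hT] [U hU]; exists (T ++ U) => p z.
by rewrite hT hU /evterms big_cat.
Qed.

Lemma polynomialM g h :
  polynomial g -> polynomial h -> polynomial (fun p z => g p z * h p z).
Proof.
move=> [T hT] [U hU].
exists [seq (t.1 * u.1, fun i => (t.2 i + u.2 i)%N) | t <- T, u <- U] => p z.
rewrite hT hU /evterms big_allpairs_dep mulr_suml; apply: eq_bigr => t _.
rewrite mulr_sumr; apply: eq_bigr => u _.
by rewrite /= monD rmorphM; ring.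
Qed.

Lemma polynomial_sum (J : Type) (s : seq J) (g : J -> R -> (I -> R) -> R) :
  (forall j, polynomial (g j)) -> polynomial (fun p z => \sum_(j <- s) g j p z).
Proof.
move=> hg; elim: s => [|j s [T hT]].
  by exists [::] => p z; rewrite /evterms !big_nil.
have [U hU] := hg j; exists (U ++ T) => p z.
by rewrite big_cons hU hT /evterms big_cat.
Qed.

End Monomials.

(** * Reduction of monomials modulo the perturbed equations, and the resultant-like polynomial
    [Q] *)

Section Elimination.
Variables (R : realType) (I : finType) (D : nat).
Variable T : I -> seq ({poly rat} * (I -> nat)).
Hypothesis degT : forall i t, t \in T i -> (\sum_j t.2 j < D)%N.

(** With [T i] representing G_i(p,z) - z_i, this is the perturbed system. *)
Definition variety (p e : R) (z : I -> R) : Prop :=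
  forall i, e * z i ^+ D = evterms (T i) p z.

Local Notation B := {ffun I -> 'I_D}.

Definition bmon (b : B) (z : I -> R) : R := mon (fun i => b i : nat) z.

(** Membership in the Q[e,p]-span of the monomials with exponents below [D], after clearing powers
    of e. [N] and [c] are the same at all points, so they can enter one fixed matrix. *)
Definition spanned (g : R -> R -> (I -> R) -> R) : Prop :=
  exists N (c : B -> {poly {poly rat}}), forall p e z, variety p e z ->
    e ^+ N * g p e z = \sum_b ev2 e p (c b) * bmon b z.

Lemma spannedD g h :
  spanned g -> spanned h -> spanned (fun p e z => g p e z + h p e z).
Proof.
move=> [N [c hc]] [M [d hd]].
exists (N + M)%N, (fun b => 'X^M * c b + 'X^N * d b) => p e z V.
rewrite mulrDr {1}addnC !exprD -!mulrA hc // hd // !mulr_sumr -big_split.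
by apply: eq_bigr => b _ /=; rewrite rmorphD !rmorphM /= !rmorphXn /= ev2X; ring.
Qed.

Lemma spannedZ (q : {poly {poly rat}}) g :
  spanned g -> spanned (fun p e z => ev2 e p q * g p e z).
Proof.
move=> [N [c hc]]; exists N, (fun b => q * c b) => p e z V.
rewrite mulrCA hc // mulr_sumr; apply: eq_bigr => b _.
by rewrite rmorphM mulrA.
Qed.

Lemma spanned_sum (J : eqType) (s : seq J) (g : J -> R -> R -> (I -> R) -> R) :
  (forall j, j \in s -> spanned (g j)) ->
  spanned (fun p e z => \sum_(j <- s) g j p e z).
Proof.
elim: s => [|j s IH] hg.
  exists 0%N, (fun=> 0) => p e z _.
  by rewrite big_nil mulr0 big1 // => b _; rewrite rmorph0 mul0r.
have [N [c hc]] : spanned (fun p e z => g j p e z + \sum_(j <- s) g j p e z).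
  by apply: spannedD; [apply: hg; rewrite mem_head |
     apply: IH => k ks; apply: hg; rewrite inE ks orbT].
by exists N, c => p e z V; rewrite big_cons hc.
Qed.

Lemma spanned_div (g h : R -> R -> (I -> R) -> R) :
  (forall p e z, variety p e z -> e * g p e z = h p e z) ->
  spanned h -> spanned g.
Proof.
move=> gh [N [c hc]]; exists N.+1, c => p e z V.
by rewrite exprSr -mulrA gh // hc.
Qed.

(** Induction on the total degree: if some exponent is at least [D], a factor z_i^D is traded for
    terms of total degree below [D], at the price of one factor e. *)
Lemma spanned_mon (a : I -> nat) : spanned (fun _ _ z => mon a z).
Proof.
have [n] := ubnP (\sum_i a i)%N; elim: n a => // n IH a.
rewrite ltnS => an.
have [aD|] := boolP [forall i, (a i < D)%N].
  have {}aD i : (a i < D)%N by exact: (forallP aD).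
  exists 0%N, (fun b => if b == [ffun i => Ordinal (aD i)] then 1 else 0) => p e z V.
  rewrite mul1r (bigD1 [ffun i => Ordinal (aD i)]) //= eqxx rmorph1 mul1r big1.
    by rewrite addr0 /bmon; apply: eq_bigr => i _; rewrite ffunE.
  by move=> b /negPf ->; rewrite rmorph0 mul0r.
rewrite negb_forall => /existsP[i]; rewrite -leqNgt => Dai.
pose a' j := if j == i then (a i - D)%N else a j.
have aE z : mon a z = mon a' z * z i ^+ D :> R.
  rewrite -(monU i) -monD; apply: eq_bigr => j _; rewrite /a'.
  by case: eqP => [->|_]; rewrite ?subnK ?addn0.
have sa : (\sum_j a j = \sum_j a' j + D)%N.
  rewrite (bigD1 i) // [in RHS](bigD1 i) //= /a' eqxx addnAC subnK //.
  by congr addn; apply: eq_bigr => j /negPf ->.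
apply: (@spanned_div _ (fun p e z => \sum_(t <- T i)
    ev2 e p t.1%:P * mon (fun j => a' j + t.2 j)%N z)).
  move=> p e z V; rewrite aE mulrCA V /evterms mulr_sumr; apply: eq_bigr => t _.
  by rewrite ev2C monD mulrCA.
apply: spanned_sum => t tT; apply/spannedZ/IH.
rewrite big_split /=; apply: leq_trans an; rewrite sa ltn_add2l.
exact: (degT tT).
Qed.

Lemma spanned_evterms U : spanned (fun p _ z => evterms U p z).
Proof.
have [N [c hc]] : spanned (fun p e z => \sum_(t <- U) ev2 e p t.1%:P * mon t.2 z).
  by elim: U => [|t U IH]; [
    exists 0%N, (fun=> 0) => p e z _;
    rewrite big_nil mulr0 big1 // => b _; rewrite rmorph0 mul0r |
    have [N [c hc]] := spannedD (spannedZ t.1%:P (spanned_mon t.2)) IH;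
    exists N, c => p e z V; rewrite big_cons hc].
exists N, c => p e z V; rewrite -hc //; congr (_ * _).
by apply: eq_bigr => t _; rewrite ev2C.
Qed.

(** The vector of all [bmon b z] is a left eigenvector, with eigenvalue e^N F(z), of a matrix over
    Q[e,p] that does not depend on the point. *)
Lemma elimination (F : R -> (I -> R) -> R) : (0 < D)%N -> polynomial F ->
  exists2 Q : {poly {poly {poly rat}}}, Q != 0 &
    forall p e z, variety p e z -> (map_poly (ev2 e p) Q).[F p z] = 0.
Proof.
move=> D0 [U hU].
have /choice[N0] : forall b : B, exists N (c : B -> {poly {poly rat}}),
    forall p e z, variety p e z ->
    e ^+ N * (F p z * bmon b z) = \sum_b' ev2 e p (c b') * bmon b' z.
  move=> b; have [N [c hc]] := spanned_evterms
    [seq (t.1, fun i => (t.2 i + b i)%N) | t <- U].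
  exists N, c => p e z V; rewrite -hc // hU /evterms big_map mulr_suml.
  congr (_ * _); apply: eq_bigr => t _.
  by rewrite -mulrA /bmon -monD.
move=> /choice[c hc].
(* One exponent that serves all columns; column j is scaled up by the missing power of e. *)
pose N := (\sum_b N0 b)%N.
have leN b : (N0 b <= N)%N by rewrite /N (bigD1 b) //= leq_addr.
pose M : 'M[{poly {poly rat}}]_#|B| :=
  \matrix_(i, j) ('X^(N - N0 (enum_val j)) * c (enum_val j) (enum_val i)).
(* Substituting e^N X for X turns the root e^N F(z) into the root F(z). The result is nonzero
   because a monic polynomial is composed with a nonconstant one. *)
exists (char_poly M \Po ('X^N *: 'X)).
  rewrite comp_poly_eq0 ?monic_neq0 ?char_poly_monic //.
  by rewrite size_scale ?size_polyX // monic_neq0 // monicXn.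
move=> p e z V.
rewrite map_comp_poly horner_comp map_char_poly map_polyZ /= map_polyX.
rewrite hornerZ hornerX rmorphXn /= ev2X.
apply/rootP; rewrite -eigenvalue_root_char; apply/eigenvalueP.
exists (\row_j bmon (enum_val j) z).
  apply/rowP => j; rewrite !mxE -mulrA.
  have -> : e ^+ N = e ^+ (N - N0 (enum_val j)) * e ^+ N0 (enum_val j).
    by rewrite -exprD subnK.
  rewrite -mulrA hc // mulr_sumr (reindex _ (onW_bij _ (@enum_val_bij B))) /=.
  apply: eq_bigr => i _; rewrite !mxE rmorphM rmorphXn /= ev2X; ring.
(* The eigenvector is nonzero: its entry at the zero exponent, available since D > 0, is 1. *)
apply/eqP => /rowP /(_ (enum_rank [ffun=> Ordinal D0])).
rewrite !mxE enum_rankK => /eqP.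
rewrite /bmon /mon big1 ?oner_eq0 // => i _.
by rewrite ffunE expr0.
Qed.

Lemma cvg_ev2 (P : {poly {poly rat}}) (p x : R) (u : R ^nat) :
  u @ \oo --> x -> (fun n => ev2 (u n) p P) @ \oo --> ev2 x p P.
Proof.
move=> ux; elim/poly_ind: P => [|P q IH].
  rewrite rmorph0; under eq_fun do rewrite rmorph0.
  exact: cvg_cst.
rewrite rmorphD rmorphM /= ev2X ev2C.
under eq_fun do rewrite rmorphD rmorphM /= ev2X ev2C.
by apply: cvgD; [exact: cvgM | exact: cvg_cst].
Qed.

Lemma cvg_horner_ev2 (Q : {poly {poly {poly rat}}}) (p x e : R) (u v : R ^nat) :
  u @ \oo --> x -> v @ \oo --> e ->
  (fun n => (map_poly (ev2 (u n) p) Q).[v n]) @ \oo -->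
    (map_poly (ev2 x p) Q).[e].
Proof.
move=> ux ve; elim/poly_ind: Q => [|Q q IH].
  rewrite raddf0 horner0.
  under eq_fun do rewrite raddf0 horner0.
  exact: cvg_cst.
rewrite rmorphD rmorphM /= map_polyX map_polyC hornerD hornerMX hornerC.
under eq_fun do rewrite rmorphD rmorphM /= map_polyX map_polyC hornerD hornerMX hornerC.
by apply: cvgD; [exact: cvgM | exact: cvg_ev2].
Qed.

(* After interchanging [e] with the eliminated variable, dividing by the largest
   power of [e] means removing the root 0. *)
Lemma elimination_limit (F : R -> (I -> R) -> R) : (0 < D)%N -> polynomial F ->
  exists2 P : {poly {poly rat}}, P != 0 &
    forall p x (e : R ^nat) (z : nat -> I -> R),
      (forall n, e n != 0) -> e @ \oo --> (0 : R) ->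
      (forall n, variety p (e n) (z n)) -> (fun n => F p (z n)) @ \oo --> x ->
      peval2 P x p = 0.
Proof.
move=> D0 /(elimination D0)[Q Q0 hQ].
have [m [Q1 Q1z Q1E]] := multiplicity_XsubC (swapXY Q) 0.
move: Q1z; rewrite swapXY_eq0 Q0 /= rootE => Q1z.
(* [P] is the cofactor at e = 0; [Q1z] says that it is nonzero. *)
exists Q1.[0] => // p x e z e0 ecv V xcv.
have Q1n n : (map_poly (ev2 (F p (z n)) p) Q1).[e n] = 0.
  have := hQ _ _ _ (V n); rewrite -horner_ev2_swapXY Q1E rmorphM rmorphXn /=.
  rewrite subr0 map_polyX hornerM hornerXn => /eqP.
  by rewrite mulf_eq0 expf_eq0 (negPf (e0 n)) andbF orbF => /eqP.
rewrite peval2E.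
have := cvg_horner_ev2 (Q := Q1) (p := p) xcv ecv.
under eq_fun do rewrite Q1n.
move=> /(cvg_lim (@Rhausdorff R)); rewrite lim_cst // => L0.
by rewrite -horner_map rmorph0 /= -L0.
Qed.

End Elimination.

(** * Stack-emptying probabilities *)

Section FixedPoint.
Variables (R : realType) (I : finType).

(* Knaster-Tarski on the box [0, zs]: [c] below solves each equation separately
   with the right-hand side frozen at the supremum of the subsolutions. *)
Lemma perturbed_fixpoint (G : (I -> R) -> I -> R) (zs : I -> R) (e : R) (D : nat) :
  0 <= e -> (0 < D)%N ->
  (forall z i, (forall j, 0 <= z j) -> 0 <= G z i) ->
  (forall z z' i, (forall j, 0 <= z j <= z' j) -> G z i <= G z' i) ->
  (forall i, 0 <= zs i) -> (forall i, G zs i <= zs i) ->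
  exists2 z : I -> R, (forall i, 0 <= z i <= zs i) &
    forall i, e * z i ^+ D + z i = G z i.
Proof.
move=> e0 D0 G0 Gmono zs0 Gzs.
pose phi x : R := e * x ^+ D + x.
have phi_lt x y : 0 <= x -> x < y -> phi x < phi y.
  move=> x0 xy; have y0 : 0 <= y by rewrite (le_trans x0) // ltW.
  by rewrite /phi ler_ltD // ler_wpM2l // lerXn2r ?nnegrE // ltW.
have phi_le x y : 0 <= x -> 0 <= y -> phi x <= phi y -> x <= y.
  by move=> x0 y0; rewrite leNgt => h; rewrite leNgt; apply: contra h; exact: phi_lt.
pose X : set (I -> R) := [set x | forall i, 0 <= x i <= zs i /\ phi (x i) <= G x i].
have X0 : X (fun=> 0).
  move=> i; split; first by rewrite lexx zs0.
  by rewrite /phi expr0n -[D == 0%N]negbK -lt0n D0 mulr0 addr0 G0.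
pose y i := sup [set x i | x in X].
have yub i : has_ubound [set x i | x in X].
  by exists (zs i) => _ [x Xx <-]; have [/andP[]] := Xx i.
have Xy x : X x -> forall i, 0 <= x i <= y i.
  move=> Xx i; have [/andP[-> _] _] := Xx i.
  by apply: ub_le_sup; [exact: yub | exists x].
have yzs i : 0 <= y i <= zs i.
  have /andP[_ ->] := Xy _ X0 i.
  apply: ge_sup; first by exists 0, (fun=> 0).
  by move=> _ [x Xx <-]; have [/andP[]] := Xx i.
(* Intermediate value theorem: phi 0 = 0 <= G y i <= G zs i <= zs i <= phi (zs i). *)
have /choice[c hc] : forall i, exists t, 0 <= t <= zs i /\ phi t = G y i.
  move=> i.
  have [||t tI] := @poly_ivt R (e *: 'X^D + 'X - (G y i)%:P) 0 (zs i) => //.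
    rewrite !hornerE expr0n -[D == 0%N]negbK -lt0n D0 mulr0 !add0r oppr_le0.
    rewrite G0 /=; last by move=> j; have /andP[] := yzs j.
    rewrite subr_ge0 (le_trans (Gmono _ _ i yzs)) // (le_trans (Gzs i)) //.
    by rewrite lerDr mulr_ge0 // exprn_ge0.
  rewrite rootE !hornerE subr_eq0 => /eqP tE; by exists t.
have c0 i : 0 <= c i by have [/andP[]] := hc i.
have yc i : y i <= c i.
  apply: ge_sup; first by exists 0, (fun=> 0).
  move=> _ [x Xx <-]; have [/andP[x0 _] xG] := Xx i.
  apply: phi_le => //; rewrite (hc i).2 (le_trans xG) //.
  by apply: Gmono; exact: Xy.
(* Since y <= c, monotonicity makes [c] a subsolution as well, whence c <= y. *)
have Xc : X c.
  move=> i; split; first exact: (hc i).1.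
  rewrite (hc i).2; apply: Gmono => j; rewrite yc.
  by have /andP[->] := yzs j.
have cE : c = y.
  apply: funext => i; apply/eqP; rewrite eq_le yc andbT.
  by have /andP[] := Xy _ Xc i.
by exists y => // i; rewrite -[RHS](hc i).2 cE.
Qed.

End FixedPoint.

(** * Emptying probabilities within a step budget and the polynomial system they lead to *)

Section Pushdown.
Variables (R : realType) (S Lam : finType) (A : pda S Lam).
Local Notation sigma := (pda_sigma A).
Local Notation rho := (pda_rho A).
Local Notation I := (S * Lam * S)%type.

(** The probability of emptying [u] in state [s'] within at most [k] steps: an empty stack counts
    whatever budget is left. *)
Fixpoint hit (p : R) (k : nat) (s : S) (u : seq Lam) (s' : S) {struct k} : R :=
  match u, k with
  | [::], _ => (s == s')%:R
  | _ :: _, 0 => 0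
  | b :: v, k'.+1 =>
      p * hit p k' (sigma s true b) (rho s true b ++ v) s' +
      (1 - p) * hit p k' (sigma s false b) (rho s false b ++ v) s'
  end.

(** An entry of the product, along [u], of the matrices z(-,b,-): the symbols of the stack are
    removed one after the other. *)
Fixpoint pop (z : I -> R) (u : seq Lam) (s s' : S) : R :=
  match u with
  | [::] => (s == s')%:R
  | b :: v => \sum_r z (s, b, r) * pop z v r s'
  end.

Definition pop_step (p : R) (z : I -> R) (i : I) : R :=
  let: (s, b, s') := i in
  p * pop z (rho s true b) (sigma s true b) s' +
  (1 - p) * pop z (rho s false b) (sigma s false b) s'.

Lemma sum_deltal (s : S) (g : S -> R) : \sum_r (s == r)%:R * g r = g s.
Proof.
rewrite (bigD1 s) //= eqxx mul1r big1 ?addr0 // => r.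
by rewrite eq_sym => /negPf ->; rewrite mul0r.
Qed.

Lemma hit_nil p k s s' : hit p k s [::] s' = (s == s')%:R.
Proof. by case: k. Qed.

Lemma pop_cat z u v s s' :
  pop z (u ++ v) s s' = \sum_r pop z u s r * pop z v r s'.
Proof.
elim: u s => [|b u IH] s /=; first by rewrite sum_deltal.
under eq_bigr do rewrite IH mulr_sumr.
rewrite exchange_big; apply: eq_bigr => r _ /=.
by rewrite mulr_suml; apply: eq_bigr => t _; rewrite mulrA.
Qed.

Lemma pop_ge0 z u s s' : (forall i, 0 <= z i) -> 0 <= pop z u s s'.
Proof.
move=> z0; elim: u s => [|b u IH] s /=; first exact: ler0n.
by apply: sumr_ge0 => r _; rewrite mulr_ge0.
Qed.

Lemma ler_pop z z' u s s' :
  (forall i, 0 <= z i <= z' i) -> pop z u s s' <= pop z' u s s'.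
Proof.
move=> zz; have z0 i : 0 <= z i by have /andP[] := zz i.
elim: u s => [|b u IH] s //=; apply: ler_sum => r _.
by have /andP[_ ?] := zz (s, b, r); rewrite ler_pM ?pop_ge0.
Qed.

Lemma polynomial_pop u s s' : polynomial (fun (_ : R) z => pop z u s s').
Proof.
elim: u s => [|b u IH] s /=.
  have [T hT] := polynomial_coef R I (if s == s' then 1 else 0).
  exists T => p z; rewrite -hT.
  by case: eqP; rewrite ?rmorph1 ?rmorph0.
by apply: polynomial_sum => r; apply: polynomialM => //; exact: polynomial_var.
Qed.

Lemma polynomial_pop_step i : polynomial (fun p z => pop_step p z i).
Proof.
case: i => [[s b] s'].
have [T hT] := polynomial_coef R I 'X; have [U hU] := polynomial_coef R I (1 - 'X).
apply: polynomialD; apply: polynomialM; try exact: polynomial_pop.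
  by exists T => p z; rewrite -hT evpX.
by exists U => p z; rewrite -hU rmorphB rmorph1 /= evpX.
Qed.

Section Bias.
Variable p : R.
Hypothesis p01 : 0 < p < 1.

Let p_ge0 : 0 <= p. Proof. by case/andP: p01 => /ltW. Qed.
Let q_ge0 : 0 <= 1 - p. Proof. by case/andP: p01 => _ /ltW; rewrite subr_ge0. Qed.

Lemma pop_step_ge0 z i : (forall j, 0 <= z j) -> 0 <= pop_step p z i.
Proof.
by case: i => [[s b] s'] z0; rewrite addr_ge0 // mulr_ge0 // pop_ge0.
Qed.

Lemma ler_pop_step z z' i :
  (forall j, 0 <= z j <= z' j) -> pop_step p z i <= pop_step p z' i.
Proof.
by case: i => [[s b] s'] zz; rewrite lerD // ler_wpM2l // ler_pop.
Qed.

Lemma hit_ge0 k s u s' : 0 <= hit p k s u s'.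
Proof.
elim: k s u => [|k IH] s [|b u] //=; try exact: ler0n.
by rewrite addr_ge0 // mulr_ge0.
Qed.

Lemma hit_le1 k s u s' : hit p k s u s' <= 1.
Proof.
elim: k s u => [|k IH] s [|b u] //=; try by rewrite lern1 leq_b1.
have := ler_wpM2l p_ge0 (IH (sigma s true b) (rho s true b ++ u)).
have := ler_wpM2l q_ge0 (IH (sigma s false b) (rho s false b ++ u)).
lra.
Qed.

Lemma hit_nondecreasing s u s' : nondecreasing_seq (fun k => hit p k s u s').
Proof.
apply/nondecreasing_seqP => k.
elim: k s u => [|k IH] s [|b u]; rewrite ?hit_nil //; first exact: hit_ge0.
by rewrite [leLHS]/= [leRHS]/= lerD // ler_wpM2l.
Qed.

(** Only an inequality, since the budget [k + l] may also be split differently between [u] and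
    [v]. *)
Lemma hit_cat k l s u v s' :
  \sum_r hit p k s u r * hit p l r v s' <= hit p (k + l) s (u ++ v) s'.
Proof.
elim: k s u => [|k IH] s [|b u].
- by under eq_bigr do rewrite hit_nil; rewrite sum_deltal.
- by rewrite /= big1 ?hit_ge0 // => r _; rewrite mul0r.
- under eq_bigr do rewrite hit_nil; rewrite sum_deltal.
  by apply: hit_nondecreasing; rewrite leq_addl.
rewrite addSn /= !catA.
under eq_bigr do rewrite mulrDl -!mulrA.
by rewrite big_split -!mulr_sumr lerD // ler_wpM2l.
Qed.

(** A supersolution up to the factor [c] bounds the emptying probabilities, each step costing one
    factor [c]. It is applied with c = 1 + e. *)
Lemma ler_hit_pop (c : R) z k s u s' : 1 <= c -> (forall i, 0 <= z i) ->
  (forall i, pop_step p z i <= c * z i) -> hit p k s u s' <= c ^+ k * pop z u s s'.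
Proof.
move=> c1 z0 hz; have c0 : 0 <= c by rewrite (le_trans _ c1).
elim: k s u => [|k IH] s [|b u].
- by rewrite /= expr0 mul1r.
- by apply: mulr_ge0; [exact: exprn_ge0 | exact: pop_ge0].
- by rewrite /= ler_peMl ?ler0n // exprn_ege1.
(* The induction hypothesis is used after the first step; [pop_cat] then separates what replaced the
   top symbol from the rest [u]. *)
apply: (@le_trans _ _ (c ^+ k * \sum_r pop_step p z (s, b, r) * pop z u r s')).
  rewrite [leLHS]/= /pop_step.
  under eq_bigr do rewrite mulrDl -!mulrA.
  rewrite big_split -!mulr_sumr -!pop_cat mulrDr !(mulrCA (c ^+ k)).
  by rewrite lerD // ler_wpM2l.
rewrite exprSr -mulrA ler_wpM2l ?exprn_ge0 //= mulr_sumr ler_sum // => r _.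
by rewrite mulrA; apply: ler_wpM2r; [exact: pop_ge0 | exact: (hz (s, b, r))].
Qed.

Definition hit_lim s u s' : R := limn (fun k => hit p k s u s').

Definition pop_prob (i : I) : R := hit_lim i.1.1 [:: i.1.2] i.2.

Lemma is_cvg_hit s u s' : cvgn (fun k => hit p k s u s').
Proof.
apply: nondecreasing_is_cvgn; first exact: hit_nondecreasing.
by exists 1 => _ [k _ <-]; exact: hit_le1.
Qed.

Lemma hit_le_lim k s u s' : hit p k s u s' <= hit_lim s u s'.
Proof.
apply: (@nondecreasing_cvgn_le _ (fun k => hit p k s u s')).
  exact: hit_nondecreasing.
exact: is_cvg_hit.
Qed.

Lemma hit_lim_ge0 s u s' : 0 <= hit_lim s u s'.
Proof. exact: le_trans (hit_ge0 0 s u s') (hit_le_lim 0 s u s'). Qed.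

Lemma hit_lim_cat s u v s' :
  \sum_r hit_lim s u r * hit_lim r v s' <= hit_lim s (u ++ v) s'.
Proof.
have cv : (fun k => \sum_r hit p k s u r * hit p k r v s') @ \oo -->
    \sum_r hit_lim s u r * hit_lim r v s'.
  apply: cvg_big => [|r _]; last by apply: cvgM; exact: is_cvg_hit.
  exact: add_continuous.
rewrite -(cvg_lim _ cv) //; apply: limr_le; first by apply: cvgP cv.
by apply: nearW => k; apply: le_trans (hit_cat k k s u v s') (hit_le_lim _ _ _ _).
Qed.

Lemma pop_prob_ge0 i : 0 <= pop_prob i.
Proof. exact: hit_lim_ge0. Qed.

Lemma pop_prob_le1 i : pop_prob i <= 1.
Proof.
apply: limr_le; first exact: is_cvg_hit.
by apply: nearW => k; exact: hit_le1.
Qed.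

Lemma pop_pop_prob u s s' : pop pop_prob u s s' <= hit_lim s u s'.
Proof.
elim: u s => [|b u IH] s /=; first by rewrite -(hit_nil p 0) hit_le_lim.
apply: le_trans (hit_lim_cat s [:: b] u s'); apply: ler_sum => r _.
by rewrite ler_wpM2l // hit_lim_ge0.
Qed.

(** This makes [pop_prob] an admissible upper corner in [perturbed_fixpoint]. It holds by a
    first-step analysis passed to the limit. *)
Lemma pop_step_pop_prob i : pop_step p pop_prob i <= pop_prob i.
Proof.
case: i => [[s b] s'].
have h x : pop pop_prob (rho s x b) (sigma s x b) s' <=
    hit_lim (sigma s x b) (rho s x b) s' by exact: pop_pop_prob.
apply: (@le_trans _ _ (p * hit_lim (sigma s true b) (rho s true b) s' +
  (1 - p) * hit_lim (sigma s false b) (rho s false b) s')).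
  by rewrite lerD // ler_wpM2l.
set H := (X in X <= _).
have cv : (fun k => hit p k.+1 s [:: b] s') @ \oo --> H.
  rewrite /=; under eq_fun do rewrite !cats0.
  by apply: cvgD; apply: cvgM; try exact: cvg_cst; exact: is_cvg_hit.
rewrite -(cvg_lim _ cv) //; apply: limr_le; first by apply: cvgP cv.
by apply: nearW => k; exact: hit_le_lim.
Qed.

End Bias.
End Pushdown.

(** * Accepted words *)

Section Language.
Variables (R : realType) (S Lam : finType) (A : pda S Lam).
Local Notation sigma := (pda_sigma A).
Local Notation rho := (pda_rho A).

(** Acceptance from an arbitrary configuration. Rejecting leftover input on an empty stack encodes
    that the stack empties for the first time at the last bit. *)
Fixpoint accepts (s : S) (u : seq Lam) (w : seq bool) {struct w} : bool :=
  match u, w with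
  | [::], [::] => s \in pda_S1 A
  | b :: v, x :: w' => accepts (sigma s x b) (rho s x b ++ v) w'
  | _, _ => false
  end.

Lemma acceptsP s u w : accepts s u w <->
  (forall k, (k < size w)%N -> (foldl (pda_step A) (s, u) (take k w)).2 != [::]) /\
  (foldl (pda_step A) (s, u) w).2 = [::] /\
  (foldl (pda_step A) (s, u) w).1 \in pda_S1 A.
Proof.
elim: w s u => [|x w IH] s [|b u] /=.
- by split=> [?|[_ []]].
- by split=> // -[_ []].
- by split=> // -[/(_ 0%N)/(_ isT)].
rewrite IH; split=> -[h1 h2]; split=> // k.
  by case: k => // k; rewrite ltnS; exact: h1.
exact: (h1 k.+1).
Qed.

Lemma pda_langE : pda_lang A true = [set w | accepts (pda_s0 A) (pda_tau A) w].
Proof. by apply/seteqP; split=> w /acceptsP. Qed.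

(** The accepted words of length at most [k], listed by the same recursion as [hit] so that their
    weights sum to [hit_accept]. *)
Fixpoint accepted_words (k : nat) (s : S) (u : seq Lam) {struct k} : seq (seq bool) :=
  match u, k with
  | [::], _ => if s \in pda_S1 A then [:: [::]] else [::]
  | _ :: _, 0 => [::]
  | b :: v, k'.+1 =>
      [seq true :: w | w <- accepted_words k' (sigma s true b) (rho s true b ++ v)] ++
      [seq false :: w | w <- accepted_words k' (sigma s false b) (rho s false b ++ v)]
  end.

Lemma mem_map_cons (x y : bool) (w : seq bool) (ws : seq (seq bool)) :
  (x :: w \in [seq y :: w' | w' <- ws]) = (x == y) && (w \in ws).
Proof.
apply/mapP/andP => [[w' ww' [-> ->]]|[/eqP -> ww]]; first by rewrite eqxx.
by exists w.
Qed.

Lemma mem_accepted_words k s u w :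
  (w \in accepted_words k s u) = accepts s u w && (size w <= k)%N.
Proof.
elim: k s u w => [|k IH] s [|b u] [|x w] /=; rewrite ?inE //.
- by case: ifP; rewrite ?inE.
- by case: ifP; rewrite ?inE.
- by rewrite andbF.
- by case: ifP; rewrite ?inE.
- by case: ifP; rewrite ?inE.
- by rewrite mem_cat; apply/negP => /orP[] /mapP[].
by rewrite mem_cat !mem_map_cons !IH ltnS; case: x; rewrite ?orbF.
Qed.

Lemma uniq_accepted_words k s u : uniq (accepted_words k s u).
Proof.
elim: k s u => [|k IH] s [|b u] //=; try by case: ifP.
rewrite cat_uniq !map_inj_uniq ?IH ?andbT; try by move=> v w [].
by apply/hasPn => _ /mapP[w _ ->]; rewrite mem_map_cons.
Qed.

Definition hit_accept (p : R) k s u : R := \sum_(s' in pda_S1 A) hit A p k s u s'.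

Lemma Pword_cons (p : R) x w :
  Pword p (x :: w) = (if x then p else 1 - p) * Pword p w.
Proof.
case: x; rewrite /Pword /n1 /n0 /=; last by rewrite add0n add1n exprS mulrCA.
by rewrite add0n add1n exprS mulrA.
Qed.

Lemma Pword_ge0 (p : R) w : 0 < p < 1 -> 0 <= Pword p w.
Proof. by case/andP=> p0 p1; rewrite mulr_ge0 // exprn_ge0 // ?subr_ge0 ltW. Qed.

Lemma sum_accepted_words (p : R) k s u :
  \sum_(w <- accepted_words k s u) Pword p w = hit_accept p k s u.
Proof.
(* An empty stack occurs for zero and for successor budgets alike, so it is settled before the
   induction. *)
have nil l r : \sum_(w <- accepted_words l r [::]) Pword p w = hit_accept p l r [::].
  rewrite /hit_accept; under [RHS]eq_bigr do rewrite hit_nil.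
  transitivity (\sum_(w <- if r \in pda_S1 A then [:: [::]] else [::]) Pword p w).
    by case: l.
  case: ifPn => rS; rewrite ?big_seq1 ?big_nil.
    rewrite (bigD1 r) //= eqxx big1 ?addr0 ?/Pword ?expr0 ?mulr1 // => t.
    by case/andP=> _; rewrite eq_sym => /negPf ->.
  rewrite big1 // => t tS; case: eqP => // rt.
  by rewrite rt tS in rS.
elim: k s u => [|k IH] s [|b u] //.
  by rewrite /hit_accept /= big_nil big1.
rewrite /= big_cat !big_map /hit_accept /= big_split -!mulr_sumr.
under eq_bigr do rewrite Pword_cons.
under [X in _ + X]eq_bigr do rewrite Pword_cons.
by rewrite -!mulr_sumr !IH.
Qed.

Lemma hit_accept_nondecreasing (p : R) s u : 0 < p < 1 ->
  nondecreasing_seq (fun k => hit_accept p k s u).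
Proof. by move=> p01 k l kl; apply: ler_sum => r _; exact: hit_nondecreasing. Qed.

(** * Approximation of the acceptance probability [x] at a fixed p *)

Section Probability.
Variables (p x : R).
Hypotheses (p01 : 0 < p < 1) (hx : Plang p (pda_lang A true) = x%:E).
Local Notation acc k := (hit_accept p k (pda_s0 A) (pda_tau A)).
Local Notation words k := (accepted_words k (pda_s0 A) (pda_tau A)).

Lemma fsum_accepted_words k :
  (\sum_(w \in [set` words k]) (Pword p w)%:E)%E = (acc k)%:E.
Proof.
by rewrite -fsbig_seq ?uniq_accepted_words // sumEFin sum_accepted_words.
Qed.

(** The words accepted within [k] steps form one of the finite subsets over which the sum of the
    language is a supremum. *)
Lemma hit_accept_le k : acc k <= x.
Proof.
rewrite -lee_fin -hx -fsum_accepted_words; apply: ereal_sup_ubound.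
exists [set` words k] => //; split; first exact: finite_seq.
by rewrite pda_langE => w /=; rewrite mem_accepted_words => /andP[].
Qed.

Lemma hit_accept_adherent (d : R) : 0 < d -> exists k, x - d < acc k.
Proof.
move=> d0; have xfin : Plang p (pda_lang A true) \is a fin_num by rewrite hx.
have [_ [X [/finite_seqP[ws ->] XL] <-]] := ub_ereal_sup_adherent d0 xfin.
rewrite -[ereal_sup _]/(Plang p (pda_lang A true)) hx -EFinB => lt.
(* A budget as long as the longest word of the nearly optimal finite set covers that set. *)
exists (\max_(w <- ws) size w)%N; rewrite -lte_fin; apply: lt_le_trans lt _.
rewrite -fsum_accepted_words; apply: lee_fsum_nneg_subset; [exact: finite_seq | exact: finite_seq | | ].
  move=> w; rewrite !inE /= => ww; rewrite mem_accepted_words.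
  have := XL w ww; rewrite pda_langE => /= ->.
  by rewrite (big_rem w) //= leq_maxl.
by move=> w _; rewrite lee_fin Pword_ge0.
Qed.

Lemma hit_accept_cvg : (fun k => acc k) @ \oo --> x.
Proof.
have -> : x = sup (range (fun k => acc k)).
  apply/eqP; rewrite eq_le; apply/andP; split.
    apply/ler_addgt0Pr => d d0; have [k kd] := hit_accept_adherent d0.
    rewrite -lerBlDr (le_trans (ltW kd)) //; apply: ub_le_sup; last by exists k.
    by exists x => _ [l _ <-]; exact: hit_accept_le.
  apply: ge_sup; first by exists (acc 0), 0%N.
  by move=> _ [l _ <-]; exact: hit_accept_le.
apply: nondecreasing_cvgn; first exact: hit_accept_nondecreasing.
by exists x => _ [l _ <-]; exact: hit_accept_le.
Qed.

Definition pop_accept (z : S * Lam * S -> R) : R :=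
  \sum_(s in pda_S1 A) pop z (pda_tau A) (pda_s0 A) s.

Lemma pop_accept_le : pop_accept (pop_prob A p) <= x.
Proof.
have cv : (fun k => acc k) @ \oo -->
    \sum_(s in pda_S1 A) hit_lim A p (pda_s0 A) (pda_tau A) s.
  apply: cvg_big => [|r _]; last exact: is_cvg_hit.
  exact: add_continuous.
rewrite -(cvg_lim _ hit_accept_cvg) // (cvg_lim _ cv) //.
by apply: ler_sum => s _; exact: pop_pop_prob.
Qed.

(** A squeeze: monotonicity and [pop_accept_le] bound the values by [x], and [ler_hit_pop] bounds
    them below by [acc k] up to (1 + e_n)^k. *)
Lemma pop_accept_cvg D (e : R ^nat) (z : nat -> S * Lam * S -> R) :
  (0 < D)%N -> (forall n, 0 <= e n) -> e @ \oo --> (0 : R) ->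
  (forall n i, 0 <= z n i <= pop_prob A p i) ->
  (forall n i, e n * z n i ^+ D + z n i = pop_step A p (z n) i) ->
  (fun n => pop_accept (z n)) @ \oo --> x.
Proof.
move=> D0 e0 ecv zb zE.
have z0 n i : 0 <= z n i by have /andP[] := zb n i.
have z1 n i : z n i <= 1.
  by have /andP[_ /le_trans] := zb n i; apply; exact: pop_prob_le1.
have zx n : pop_accept (z n) <= x.
  apply: le_trans pop_accept_le; apply: ler_sum => s _; exact: ler_pop.
(* As 0 <= z <= 1 and D >= 1, the equation gives G z = e z^D + z <= (1 + e) z. *)
have lower k n : acc k <= (1 + e n) ^+ k * pop_accept (z n).
  rewrite mulr_sumr; apply: ler_sum => s _; apply: ler_hit_pop => //.
    by rewrite lerDl.
  move=> i; rewrite -zE mulrDl mul1r addrC lerD2l ler_wpM2l //.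
  by rewrite -[leRHS]expr1 ler_wiXn2l.
apply/cvgrPdist_lt => d d0.
have d2 : 0 < d / 2 by rewrite divr_gt0.
(* The budget [k] is fixed before [n]: half of [d] pays for truncating at [k], the other half for
   the factor (1 + e_n)^k. *)
have [k kd] := hit_accept_adherent d2.
have cvk : (fun n => (1 + e n) ^+ k * x) @ \oo --> ((1 + 0) ^+ k * x : R).
  apply: cvgM; last exact: cvg_cst.
  elim: k {kd} => [|k IH]; first by under eq_fun do rewrite expr0; exact: cvg_cst.
  under eq_fun do rewrite exprS.
  by rewrite exprS; apply: cvgM IH; apply: cvgD => //; exact: cvg_cst.
rewrite addr0 expr1n mul1r in cvk.
near=> n.
have := zx n; have := lower k n.
have : `|x - (1 + e n) ^+ k * x| < d / 2.
  by near: n; by move/cvgrPdist_lt : cvk; apply.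
rewrite ltr_distl => /andP[+ _].
have : 1 <= (1 + e n) ^+ k by rewrite exprn_ege1 // lerDl.
set c := _ ^+ k; set y := pop_accept _ => c1 cx accy yx.
(* Hence y >= c y - (c - 1) x > (x - d/2) - d/2. *)
have cy : (c - 1) * y <= (c - 1) * x by rewrite ler_wpM2l // subr_ge0.
rewrite ger0_norm ?subr_ge0 //; lra.
Unshelve. all: by end_near.
Qed.

End Probability.
End Language.

Theorem theorem2 (R : realType) (f : R -> R)
  (hf : forall p : R, 0 < p < 1 -> 0 < f p < 1) :
  (exists (S Lam : finType) (A : pda S Lam),
      pda_simulates A [set p : R | 0 < p < 1] f) ->
  exists P : {poly {poly rat}},
    P != 0 /\ forall p : R, 0 < p < 1 -> peval2 P (f p) p = 0.
Proof.
move=> [S [Lam [A [_ _ _ hL1]]]].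
(* The term z_i is moved to the right-hand side to match the form of [variety]. *)
have /choice[T hT] : forall i, exists T, forall (p : R) z,
    pop_step A p z i - z i = evterms T p z.
  move=> i; have [T hT] := polynomialD (polynomial_pop_step R A i)
    (polynomialM (polynomial_coef R _ (-1)) (polynomial_var R i)).
  by exists T => p z; rewrite -hT rmorphN1 mulN1r.
(* The successor makes [D] exceed every total degree and also makes it positive. *)
pose D := (\max_i \max_(t <- T i) \sum_j t.2 j).+1%N.
have degT i t : t \in T i -> (\sum_j t.2 j < D)%N.
  by move=> tT; rewrite ltnS (bigop.bigmax_sup i) // (big_rem t) //= leq_maxl.
have [|P P0 hP] := elimination_limit (R := R) degT (F := fun _ z => pop_accept A z) isT.
  have [U hU] := polynomial_sum (enum (pda_S1 A))
    (fun s => polynomial_pop R (pda_tau A) (pda_s0 A) s).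
  by exists U => p z; rewrite -hU big_enum.
exists P; split=> // p p01.
(* The perturbation parameter runs through e_n = 1/(n+1), which is positive and tends to 0. *)
have [z zb zE] : exists2 z : nat -> S * Lam * S -> R,
    (forall n i, 0 <= z n i <= pop_prob A p i) &
    (forall n i, harmonic n * z n i ^+ D + z n i = pop_step A p (z n) i).
  have /choice[z hz] : forall n, exists z : S * Lam * S -> R,
      (forall i, 0 <= z i <= pop_prob A p i) /\
      (forall i, harmonic n * z i ^+ D + z i = pop_step A p z i).
    move=> n; have [z zb zE] := perturbed_fixpoint (harmonic_ge0 n : 0 <= _ :> R)
      (ltn0Sn _ : 0 < D)%N (fun z i => @pop_step_ge0 R _ _ A p p01 z i)
      (@ler_pop_step R _ _ A p p01) (pop_prob_ge0 A p01)
      (pop_step_pop_prob A p01).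
    by exists z.
  by exists z => n; [exact: (hz n).1 | exact: (hz n).2].
apply: (hP p (f p) (@harmonic R) z).
- by move=> n; rewrite gt_eqF // harmonic_gt0.
- exact: cvg_harmonic.
- by move=> n i; rewrite -hT -zE addrK.
- apply: (pop_accept_cvg p01 (hL1 p p01) _ _ _ zb zE) => //.
  + exact: harmonic_ge0.
  + exact: cvg_harmonic.
Qed.
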